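(* Let $\mathbf v\in\mathbb R_{>0}^m$, $\tau=\sum_iv_i^2k_i$, and let $\mathcal V\in\mathcal P_{\mathbf v}(m,\mathbf k,d)$ be irreducible. Then the smooth map $\mathrm{RSO}:\mathcal P_{\mathbf v}\to\mathcal G\ell(d)^+_\tau$, $\mathrm{RSO}(\mathcal U)=S_{\mathcal U}$, has a smooth local cross section around $S_{\mathcal V}$ sending $S_{\mathcal V}$ to $\mathcal V$: there exist an open neighborhood $A$ of $S_{\mathcal V}$ in $\mathcal G\ell(d)^+_\tau$ and a smooth map $\rho:A\to\mathcal P_{\mathbf v}$ such that $S_{\rho(S)}=S$ for all $S\in A$ and $\rho(S_{\mathcal V})=\mathcal V$.
   Context: Fix integers $m,d\ge1$ and $\mathbf k=(k_1,\dots,k_m)\in\mathbb N^m$ with each $k_i\le d$. A system is an $m$-tuple $\mathcal V=(V_i)_{i=1}^m$ with $V_i\in L(\mathbb C^d,\mathbb C^{k_i})$; its RS operator is $S_{\mathcal V}=\sum_iV_i^*V_i$, and $\mathcal V$ is a reconstruction system (RS) if $S_{\mathcal V}$ is invertible. Given weights $\mathbf v=(v_i)\in\mathbb R_{>0}^m$, $\mathcal P_{\mathbf v}=\mathcal P_{\mathbf v}(m,\mathbf k,d)$ is the set of RS's with $V_iV_i^*=v_i^2I_{k_i}$ for all $i$ (projective RS's with weights $\mathbf v$); then $\operatorname{tr}S_{\mathcal V}=\tau:=\sum_iv_i^2k_i$. A system $\mathcal V\in\mathcal P_{\mathbf v}$ is irreducible if the commutant $\{A\in M_d(\mathbb C):AV_i^*V_i=V_i^*V_iA\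 \forall i\}$ equals $\mathbb C I_d$. Let $\mathcal I(k,d)=\{U\in L(\mathbb C^k,\mathbb C^d):U^*U=I_k\}$ and $\mathcal I(\mathbf k,d)=\prod_i\mathcal I(k_i,d)$ (product manifold). The map $\mathcal V\mapsto(v_i^{-1}V_i^* )_i$ is a bijection of $\mathcal P_{\mathbf v}$ onto the open subset $\mathcal I_0(\mathbf k,d)=\{(U_i)\in\mathcal I(\mathbf k,d):\sum_iU_iU_i^*\text{ invertible}\}$; $\mathcal P_{\mathbf v}$ carries the smooth structure making this bijection a diffeomorphism. $\mathcal G\ell(d)^+_\tau$ is the manifold of positive definite $d\times d$ matrices with trace $\tau$ (an open subset of the affine space of Hermitian matrices of trace $\tau$). *)

(* Defs.v *)
(* classical reals.  Complex numbers are modelled as pairs of reals,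
   complex matrices as functions nat -> nat -> C (only entries in range matter). *)
From Stdlib Require Import Reals.
Open Scope R_scope.

Definition C : Type := (R * R)%type.
Definition C0 : C := (0, 0).
Definition C1 : C := (1, 0).
Definition RtoC (r : R) : C := (r, 0).
Definition Cadd (x y : C) : C := (fst x + fst y, snd x + snd y).
Definition Cmul (x y : C) : C :=
  (fst x * fst y - snd x * snd y, fst x * snd y + snd x * fst y).
Definition Cconj (x : C) : C := (fst x, - snd x).

Fixpoint Csum (n : nat) (f : nat -> C) : C :=
  match n with
  | O => C0
  | S n' => Cadd (Csum n' f) (f n')
  end.

Definition Mat : Type := nat -> nat -> C.

Definition mmul (q : nat) (A B : Mat) : Mat :=
  fun i j => Csum q (fun l => Cmul (A i l) (B l j)).
Definition adj (A : Mat) : Mat := fun i j => Cconj (A j i).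
Definition scalar_mx (c : C) : Mat :=
  fun i j => if Nat.eq_dec i j then c else C0.
Definition idm : Mat := scalar_mx C1.
Definition meq (p q : nat) (A B : Mat) : Prop :=
  forall i j, (i < p)%nat -> (j < q)%nat -> A i j = B i j.
Definition msum (n : nat) (F : nat -> Mat) : Mat :=
  fun i j => Csum n (fun l => F l i j).
Definition mtrace (d : nat) (A : Mat) : C := Csum d (fun a => A a a).
Definition invertible (d : nat) (A : Mat) : Prop :=
  exists B, meq d d (mmul d A B) idm /\ meq d d (mmul d B A) idm.

(** * Systems: V i is a (k i) x d matrix, i < m *)
Definition system : Type := nat -> Mat.

Definition RSop (m : nat) (k : nat -> nat) (V : system) : Mat :=
  msum m (fun i => mmul (k i) (adj (V i)) (V i)).

Definition is_RS (m d : nat) (k : nat -> nat) (V : system) : Prop :=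
  invertible d (RSop m k V).

Definition in_Pv (m d : nat) (k : nat -> nat) (v : nat -> R) (V : system) : Prop :=
  is_RS m d k V /\
  forall i, (i < m)%nat ->
    meq (k i) (k i) (mmul d (V i) (adj (V i))) (scalar_mx (RtoC (v i ^ 2))).

Definition irreducible (m d : nat) (k : nat -> nat) (V : system) : Prop :=
  forall A : Mat,
    (forall i, (i < m)%nat ->
       meq d d (mmul d A (mmul (k i) (adj (V i)) (V i)))
               (mmul d (mmul (k i) (adj (V i)) (V i)) A)) ->
    exists c : C, meq d d A (scalar_mx c).

Definition hermitian (d : nat) (A : Mat) : Prop := meq d d A (adj A).
Definition qform (d : nat) (A : Mat) (x : nat -> C) : C :=
  Csum d (fun a => Cmul (Cconj (x a)) (Csum d (fun b => Cmul (A a b) (x b)))).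
Definition pos_def (d : nat) (A : Mat) : Prop :=
  hermitian d A /\
  forall x : nat -> C, (exists a, (a < d)%nat /\ x a <> C0) -> 0 < fst (qform d A x).
Definition in_Glpos_tau (d : nat) (tau : R) (A : Mat) : Prop :=
  pos_def d A /\ mtrace d A = RtoC tau.

Definition close (d : nat) (delta : R) (X Y : Mat) : Prop :=
  forall a b, (a < d)%nat -> (b < d)%nat ->
    Rabs (fst (Y a b) - fst (X a b)) < delta /\
    Rabs (snd (Y a b) - snd (X a b)) < delta.

Definition mx_open (d : nat) (U : Mat -> Prop) : Prop :=
  forall X, U X -> exists delta, 0 < delta /\ forall Y, close d delta X Y -> U Y.

Definition cont_on (d : nat) (U : Mat -> Prop) (g : Mat -> R) : Prop :=
  forall X, U X -> forall eps, 0 < eps ->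
    exists delta, 0 < delta /\ forall Y, close d delta X Y -> Rabs (g Y - g X) < eps.

Definition upd (X : Mat) (a b : nat) (p : bool) (t : R) : Mat :=
  fun i j => if andb (Nat.eqb i a) (Nat.eqb j b)
             then (if p then (fst (X i j) + t, snd (X i j))
                        else (fst (X i j), snd (X i j) + t))
             else X i j.

Fixpoint Ck (d : nat) (n : nat) (U : Mat -> Prop) (g : Mat -> R) : Prop :=
  match n with
  | O => cont_on d U g
  | S n' => cont_on d U g /\
      forall a b (p : bool), (a < d)%nat -> (b < d)%nat ->
        exists g' : Mat -> R,
          (forall X, U X -> derivable_pt_lim (fun t => g (upd X a b p t)) 0 (g' X)) /\
          Ck d n' U g'
  end.

Definition smooth_real (d : nat) (U : Mat -> Prop) (g : Mat -> R) : Prop :=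
  forall n, Ck d n U g.

Definition smooth_sys (d m : nat) (k : nat -> nat) (U : Mat -> Prop)
  (G : Mat -> system) : Prop :=
  forall i r c, (i < m)%nat -> (r < k i)%nat -> (c < d)%nat ->
    smooth_real d U (fun X => fst (G X i r c)) /\
    smooth_real d U (fun X => snd (G X i r c)).

Definition smooth_sys_on_subset (d m : nat) (k : nat -> nat) (A : Mat -> Prop)
  (F : Mat -> system) : Prop :=
  forall X, A X ->
    exists W : Mat -> Prop, mx_open d W /\ W X /\
    exists G : Mat -> system, smooth_sys d m k W G /\
      forall Y, W Y -> A Y -> forall i, (i < m)%nat -> meq (k i) d (G Y i) (F Y i).

(* Main.v *)
Require Import Defs.
From Stdlib Require Import Reals Lra FunctionalExtensionality IndefiniteDescription.
From HB Require structures.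
From mathcomp Require all_boot all_order all_algebra complex Rstruct ring lra.
Open Scope R_scope.

(** Write P_i = V_i^* V_i and look for the system in the form V_i W_i with W_i
    unitary, so that V_i W_i W_i^* V_i^* = v_i^2 I is automatic; with
    W_i = I + h_i the equations W_i W_i^* = I and sum_i W_i^* P_i W_i = S are
    quadratic in h, namely L h + Q(h,h) = (0, S - S_V).  A covector (A_i, B) in
    the cokernel of the linear part L satisfies A_i' + B' P_i = 0, where A', B'
    are the Hermitian parts; so B' commutes with all P_i, hence is scalar by
    irreducibility, and such a covector annihilates (0, S - S_V) - Q(h,h)
    because tr S = tr S_V.  Applying a right inverse of L turns the equations
    into h = y(S) - q(h,h) with y affine and y(S_V) = 0, which a contraction
    solves near S_V.  The partial derivatives of h are entries of
    e (I + 2 q(h,.))^{-1}, i.e. rational functions of h, which gives smoothness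
    of every order by induction. *)

(** * Functions closed under partial derivatives *)

Lemma upd_zero (X : Mat) a b p : upd X a b p 0 = X.
Proof.
apply functional_extensionality; intro i; apply functional_extensionality; intro j.
unfold upd; destruct (andb _ _); [|reflexivity].
destruct (X i j) as [x y]; destruct p; simpl; f_equal; ring.
Qed.

Lemma close_min d e1 e2 X Y :
  close d (Rmin e1 e2) X Y -> close d e1 X Y /\ close d e2 X Y.
Proof.
intro H; split; intros a b ha hb; destruct (H a b ha hb) as [H1 H2];
  pose proof (Rmin_l e1 e2); pose proof (Rmin_r e1 e2); split; lra.
Qed.

Lemma cont_on_const d U c : cont_on d U (fun _ => c).
Proof.
intros X _ eps he; exists 1; split; [lra|intros Y _].
now rewrite Rminus_diag, Rabs_R0.
Qed.

Lemma cont_on_add d U f g :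
  cont_on d U f -> cont_on d U g -> cont_on d U (fun X => f X + g X).
Proof.
intros Hf Hg X UX eps he.
destruct (Hf X UX (eps / 2)) as [d1 [hd1 H1]]; [lra|].
destruct (Hg X UX (eps / 2)) as [d2 [hd2 H2]]; [lra|].
exists (Rmin d1 d2); split; [now apply Rmin_pos|intros Y HY].
apply close_min in HY as [HY1 HY2].
specialize (H1 Y HY1); specialize (H2 Y HY2).
replace (f Y + g Y - (f X + g X)) with ((f Y - f X) + (g Y - g X)) by ring.
eapply Rle_lt_trans; [apply Rabs_triang|lra].
Qed.

Lemma cont_on_mul d U f g :
  cont_on d U f -> cont_on d U g -> cont_on d U (fun X => f X * g X).
Proof.
intros Hf Hg X UX eps he.
pose proof (Rabs_pos (f X)) as pf; pose proof (Rabs_pos (g X)) as pg.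
set (C := 1 + Rabs (f X) + Rabs (g X)).
assert (hC : 0 < C) by (unfold C; lra).
(* With increments of [f] and [g] below [e <= 1], the product changes by at most [e * e + e * Rabs
   (f X) + e * Rabs (g X) <= e * C <= eps]. *)
set (e := Rmin 1 (eps / C)).
assert (he' : 0 < e) by (apply Rmin_pos; [lra|now apply Rdiv_lt_0_compat]).
assert (e1 : e <= 1) by apply Rmin_l.
assert (eC : e * C <= eps).
{ apply Rle_trans with (eps / C * C);
    [apply Rmult_le_compat_r; [lra|apply Rmin_r]|right; field; lra]. }
destruct (Hf X UX e he') as [d1 [hd1 H1]].
destruct (Hg X UX e he') as [d2 [hd2 H2]].
exists (Rmin d1 d2); split; [now apply Rmin_pos|intros Y HY].
apply close_min in HY as [HY1 HY2].
specialize (H1 Y HY1); specialize (H2 Y HY2).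
replace (f Y * g Y - f X * g X) with
  ((f Y - f X) * (g Y - g X) + (f X * (g Y - g X) + g X * (f Y - f X))) by ring.
eapply Rle_lt_trans; [apply Rabs_triang|].
eapply Rle_lt_trans; [apply Rplus_le_compat_l, Rabs_triang|].
rewrite !Rabs_mult.
pose proof (Rabs_pos (f Y - f X)); pose proof (Rabs_pos (g Y - g X)).
unfold C in eC; nra.
Qed.

Lemma cont_on_comp d U f phi :
  cont_on d U f -> (forall X, U X -> continuity_pt phi (f X)) ->
  cont_on d U (fun X => phi (f X)).
Proof.
intros Hf Hphi X UX eps he.
destruct (Hphi X UX eps he) as [e [he' He]].
destruct (Hf X UX e he') as [delta [hdelta H]].
exists delta; split; [assumption|intros Y HY].
destruct (Req_dec (f Y) (f X)) as [E|NE].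
- now rewrite E, Rminus_diag, Rabs_R0.
- apply He; split; [split; [exact I|congruence]|now apply H].
Qed.

(** Inversion is included because the derivatives of the fixed point are entries of an inverse
    matrix. Nonvanishing is demanded on [U] only, the one place where continuity and derivatives
    matter. *)
Inductive rational_in (U : Mat -> Prop) (F : (Mat -> R) -> Prop) :
    (Mat -> R) -> Prop :=
| rational_gen f : F f -> rational_in U F f
| rational_const c : rational_in U F (fun _ => c)
| rational_add f g : rational_in U F f -> rational_in U F g ->
    rational_in U F (fun X => f X + g X)
| rational_mul f g : rational_in U F f -> rational_in U F g ->
    rational_in U F (fun X => f X * g X)
| rational_inv f : rational_in U F f -> (forall X, U X -> f X <> 0) ->
    rational_in U F (fun X => / f X).

Lemma rational_ext U F f g :
  (forall X, f X = g X) -> rational_in U F f -> rational_in U F g.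
Proof. intros E; now rewrite (functional_extensionality f g E). Qed.

Lemma rational_opp U F f : rational_in U F f -> rational_in U F (fun X => - f X).
Proof.
intro Hf; apply rational_ext with (fun X => -1 * f X); [intro; ring|].
apply rational_mul; [apply rational_const|assumption].
Qed.

Definition is_partial (U : Mat -> Prop) a b p (f f' : Mat -> R) : Prop :=
  forall X, U X -> derivable_pt_lim (fun t => f (upd X a b p t)) 0 (f' X).

Section Closed.
Variables (d : nat) (U : Mat -> Prop) (F : (Mat -> R) -> Prop).
Hypothesis F_cont : forall f, F f -> cont_on d U f.
Hypothesis F_deriv : forall f a b p, F f -> (a < d)%nat -> (b < d)%nat ->
  exists f', rational_in U F f' /\ is_partial U a b p f f'.

Lemma rational_cont f : rational_in U F f -> cont_on d U f.
Proof.
induction 1.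
- now apply F_cont.
- apply cont_on_const.
- now apply cont_on_add.
- now apply cont_on_mul.
- apply (cont_on_comp d U f Rinv); [assumption|intros X UX].
  apply (continuity_pt_inv id); [apply derivable_continuous_pt, derivable_pt_id|now apply H0].
Qed.

Lemma rational_partial f a b p : rational_in U F f -> (a < d)%nat -> (b < d)%nat ->
  exists f', rational_in U F f' /\ is_partial U a b p f f'.
Proof.
intros Hf ha hb; induction Hf as [f Ff|c|f g Hf [f' [Rf Df]] Hg [g' [Rg Dg]]
  |f g Hf [f' [Rf Df]] Hg [g' [Rg Dg]]|f Hf [f' [Rf Df]] nz].
- now apply F_deriv.
- exists (fun _ => 0); split; [apply rational_const|intros X _].
  apply derivable_pt_lim_const.
- exists (fun X => f' X + g' X); split; [now apply rational_add|intros X UX].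
  apply (derivable_pt_lim_plus (fun t => f (upd X a b p t)) (fun t => g (upd X a b p t)));
    auto.
- exists (fun X => f' X * g X + f X * g' X); split.
  + now apply rational_add; apply rational_mul.
  + intros X UX.
    pose proof (derivable_pt_lim_mult (fun t => f (upd X a b p t))
      (fun t => g (upd X a b p t)) 0 _ _ (Df X UX) (Dg X UX)) as D.
    now cbv beta in D; rewrite upd_zero in D.
- exists (fun X => - f' X * (/ f X * / f X)); split.
  + apply rational_mul; [now apply rational_opp|].
    apply rational_mul; now apply rational_inv.
  + intros X UX.
    assert (nz0 : f (upd X a b p 0) <> 0) by (rewrite upd_zero; now apply nz).
    pose proof (derivable_pt_lim_div (fct_cte 1) (fun t => f (upd X a b p t)) 0 _ _
      (derivable_pt_lim_const 1 0) (Df X UX) nz0) as D.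
    cbv beta in D; rewrite upd_zero in D; unfold fct_cte, Rsqr, div_fct in D.
    replace (- f' X * (/ f X * / f X)) with ((0 * f X - f' X * 1) / (f X * f X))
      by (field; now apply nz).
    (* The quotient rule speaks of [1 / f]; unfolding the limit lets the factor [1] be cancelled. *)
    intros eps he; destruct (D eps he) as [delta Hd]; exists delta; intros h nh hh.
    specialize (Hd h nh hh); unfold Rdiv in *; now rewrite !Rmult_1_l in Hd.
Qed.

(* The derivatives stay in the same class of functions, so [Ck] follows by
   induction without ever computing an iterated derivative. *)
Lemma rational_smooth f : rational_in U F f -> smooth_real d U f.
Proof.
intros Hf n; revert f Hf; induction n as [|n IH]; intros f Hf.
- now apply rational_cont.
- split; [now apply rational_cont|intros a b p ha hb].
  destruct (rational_partial f a b p Hf ha hb) as [f' [Rf Df]].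
  exists f'; split; [exact Df|now apply IH].
Qed.

End Closed.

(** Dividing the error by [t] leaves at most [C * Rabs t], which tends to 0. *)
Lemma derivable_pt_lim_quadratic_error (f : R -> R) (l C r : R) :
  0 < r -> (forall t, Rabs t < r -> Rabs (f t - f 0 - l * t) <= C * (t * t)) ->
  derivable_pt_lim f 0 l.
Proof.
intros hr H eps he.
(* The bound at [t = r / 2] already forces [C] to be nonnegative. *)
assert (hC : 0 <= C).
{ assert (h2 : Rabs (r / 2) < r) by (rewrite Rabs_pos_eq; lra).
  specialize (H (r / 2) h2); pose proof (Rabs_pos (f (r / 2) - f 0 - l * (r / 2))).
  assert (0 < r / 2 * (r / 2)) by (apply Rmult_lt_0_compat; lra); nra. }
assert (hd : 0 < Rmin r (eps / (C + 1))).
{ apply Rmin_pos; [assumption|apply Rdiv_lt_0_compat; lra]. }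
exists (mkposreal _ hd); intros t nt ht; simpl in ht.
assert (t1 : Rabs t < r) by (eapply Rlt_le_trans; [exact ht|apply Rmin_l]).
assert (t2 : Rabs t < eps / (C + 1)) by (eapply Rlt_le_trans; [exact ht|apply Rmin_r]).
specialize (H t t1); rewrite Rplus_0_l.
replace ((f t - f 0) / t - l) with ((f t - f 0 - l * t) * / t) by (field; auto).
assert (pt : 0 < Rabs t) by now apply Rabs_pos_lt.
rewrite Rabs_mult, Rabs_inv.
apply Rmult_lt_reg_r with (Rabs t); [assumption|].
rewrite Rmult_assoc, Rinv_l, Rmult_1_r by lra.
replace (t * t) with (Rabs t * Rabs t) in H
  by (rewrite <- Rabs_mult; apply Rabs_pos_eq; nra).
eapply Rle_lt_trans; [exact H|].
assert (Rabs t * (C + 1) < eps).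
{ apply Rmult_lt_reg_r with (/ (C + 1)); [apply Rinv_0_lt_compat; lra|].
  rewrite Rmult_assoc, Rinv_r, Rmult_1_r by lra; exact t2. }
nra.
Qed.

Lemma upd_close d X a b p t delta : Rabs t < delta -> close d delta X (upd X a b p t).
Proof.
intros ht i j _ _; assert (0 < delta) by (pose proof (Rabs_pos t); lra).
unfold upd; destruct (andb _ _); destruct (X i j) as [x y]; [destruct p|]; simpl;
  split; first [now rewrite Rminus_diag, Rabs_R0|now rewrite Rplus_minus_l].
Qed.

Definition rational_C U F (f : Mat -> Defs.C) : Prop :=
  rational_in U F (fun X => fst (f X)) /\ rational_in U F (fun X => snd (f X)).

Lemma rational_C_const U F z : rational_C U F (fun _ => z).
Proof. split; apply rational_const. Qed.

Lemma rational_C_mul U F f g : rational_C U F f -> rational_C U F g ->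
  rational_C U F (fun X => Cmul (f X) (g X)).
Proof.
intros [f1 f2] [g1 g2]; split; simpl.
- apply rational_add; [|apply rational_opp]; now apply rational_mul.
- apply rational_add; now apply rational_mul.
Qed.

Lemma rational_C_sum U F n (f : nat -> Mat -> Defs.C) :
  (forall l, rational_C U F (f l)) -> rational_C U F (fun X => Csum n (fun l => f l X)).
Proof.
intro Hf; induction n as [|n [IH1 IH2]]; [exact (rational_C_const U F C0)|].
destruct (Hf n) as [H1 H2].
split; simpl; apply rational_add; assumption.
Qed.

Module MatrixEquation.

Import structures all_boot all_order all_algebra.
Import complex Rstruct ring lra.
Set Implicit Arguments.
Unset Strict Implicit.
Unset Printing Implicit Defensive.
Import Order.TTheory GRing.Theory Num.Theory.
Local Open Scope ring_scope.

(** * A quadratic fixed-point equation *)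

(** This is the passage to the limit in [k]: if [a < x], some power of 2 exceeds [c / (x - a)]. *)
Lemma le_geometric_error (a c x : R) :
  (forall k, x <= a + c * 2^-1 ^+ k) -> x <= a.
Proof.
move=> H; rewrite leNgt; apply/negP => ltax.
have xa : 0 < x - a by rewrite subr_gt0.
pose k := Num.bound (c / (x - a)).
have := @upper_nthrootP _ (c / (x - a)) k (leqnn _).
rewrite ltr_pdivrMr // => lt_c.
have := H k; rewrite exprVn -lerBlDl ler_pdivlMr ?exprn_gt0 // mulrC leNgt.
by rewrite lt_c.
Qed.

(** The intervals of radius [e k] around [u k] are nested, so the supremum of their left endpoints
    lies in all of them. *)
Lemma geometric_limit (u : nat -> R) (C : R) :
  (forall k, `|u k.+1 - u k| <= C * 2^-1 ^+ k) ->
  exists l, forall k, `|u k - l| <= 2 * C * 2^-1 ^+ k.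
Proof.
move=> H.
(* The radius is the tail from [k] on of the geometric series that bounds the steps. *)
pose e k := 2 * C * 2^-1 ^+ k.
have eS k : e k = e k.+1 + C * 2^-1 ^+ k by rewrite /e exprS; lra.
have e0 k : 0 <= e k.
  by rewrite /e -mulrA mulr_ge0 //; apply: le_trans (H k).
have step k : (u k - e k <= u k.+1 - e k.+1) /\ (u k.+1 + e k.+1 <= u k + e k).
  by have := H k; rewrite ler_norml (eS k) => /andP[]; split; lra.
have lo k j : u k - e k <= u (k + j)%N - e (k + j)%N.
  elim: j => [|j IH]; first by rewrite addn0.
  by rewrite addnS; apply: le_trans IH (step _).1.
have hi k j : u (k + j)%N + e (k + j)%N <= u k + e k.
  elim: j => [|j IH]; first by rewrite addn0.
  by rewrite addnS; apply: le_trans (step _).2 IH.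
(* Both endpoints are compared with the interval of index [maxn k j]. *)
have cross k j : u k - e k <= u j + e j.
  have := lo k (maxn k j - k)%N; have := hi j (maxn k j - j)%N.
  rewrite !subnKC ?leq_maxl ?leq_maxr //.
  by have := e0 (maxn k j); lra.
pose E x := exists k, x = u k - e k.
have bE : bound E.
  by exists (u 0%N + e 0%N) => _ [k ->]; apply/RleP; apply: cross.
have [|l [ubl lubl]] := completeness E bE; first by exists (u 0%N - e 0%N), 0%N.
exists l => k; rewrite -/(e k) ler_norml.
have h1 : u k - e k <= l by apply/RleP; apply: ubl; exists k.
have h2 : l <= u k + e k.
  by apply/RleP; apply: lubl => _ [j ->]; apply/RleP; apply: cross.
by apply/andP; split; lra.
Qed.

(** * The l1 norm on row vectors *)

Section L1norm.
Variable n : nat.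
Implicit Types x y w : 'rV[R]_n.

Definition l1 x : R := \sum_i `|x 0 i|.

Lemma l1_ge0 x : 0 <= l1 x. Proof. exact: sumr_ge0. Qed.

Lemma l1_0 : l1 0 = 0.
Proof. by rewrite /l1 big1 // => i _; rewrite mxE normr0. Qed.

Lemma l1_entry x i : `|x 0 i| <= l1 x.
Proof. by rewrite /l1 (bigD1 i) //= lerDl sumr_ge0. Qed.

Lemma l1D x y : l1 (x + y) <= l1 x + l1 y.
Proof. by rewrite /l1 -big_split ler_sum // => i _; rewrite mxE ler_normD. Qed.

Lemma l1Z (a : R) x : l1 (a *: x) = `|a| * l1 x.
Proof. by rewrite /l1 mulr_sumr; apply: eq_bigr => i _; rewrite mxE normrM. Qed.

Lemma l1N x : l1 (- x) = l1 x.
Proof. by rewrite -scaleN1r l1Z normrN1 mul1r. Qed.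

Lemma l1B x y : l1 (x - y) <= l1 x + l1 y.
Proof. by rewrite -(l1N y) l1D. Qed.

Lemma l1_eq0 x : l1 x <= 0 -> x = 0.
Proof.
move=> le0; apply/rowP => i; rewrite mxE; apply/normr0_eq0/le_anti.
by rewrite normr_ge0 (le_trans (l1_entry x i)).
Qed.

Lemma l1_sum (I : finType) (F : I -> 'rV[R]_n) : l1 (\sum_i F i) <= \sum_i l1 (F i).
Proof.
elim/big_rec2: _ => [|i a x _ IH]; first by rewrite l1_0.
by apply: le_trans (l1D _ _) _; rewrite lerD2l.
Qed.

Lemma l1_geometric_limit (u : nat -> 'rV[R]_n) (C : R) :
  (forall k, l1 (u k.+1 - u k) <= C * 2^-1 ^+ k) ->
  exists l, forall k, l1 (u k - l) <= (2 * C * n%:R) * 2^-1 ^+ k.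
Proof.
move=> H.
have ent i : exists l, forall k, `|u k 0 i - l| <= 2 * C * 2^-1 ^+ k.
  apply: geometric_limit => k; apply: le_trans (H k).
  by have := l1_entry (u k.+1 - u k) i; rewrite !mxE.
have [f Hf] := fin_all_exists ent.
exists (\row_i f i) => k.
apply: (@le_trans _ _ (\sum_(i < n) 2 * C * 2^-1 ^+ k)).
  by apply: ler_sum => i _; rewrite !mxE; apply: Hf.
by rewrite sumr_const card_ord -mulr_natr; lra.
Qed.

End L1norm.

Ltac rowring := apply/rowP => ?; rewrite !mxE; ring.

Section QuadraticFixedPoint.
Variables (n : nat) (q : 'rV[R]_n -> 'rV[R]_n -> 'rV[R]_n) (K : R).
Hypothesis q_linear : forall x, linear (q x).
Hypothesis qC : forall x y, q x y = q y x.
Hypothesis K_gt0 : 0 < K.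
Hypothesis q_bound : forall x y, l1 (q x y) <= K * l1 x * l1 y.
Implicit Types x y h : 'rV[R]_n.

Lemma q_addr x y w : q x (y + w) = q x y + q x w.
Proof. by have := q_linear x 1 y w; rewrite !scale1r. Qed.

Lemma q_oppr x y : q x (- y) = - q x y.
Proof.
have q0 : q x 0 = 0 by apply: (addrI (q x 0)); rewrite -q_addr !addr0.
by have := q_linear x (-1) y 0; rewrite !scaleN1r q0 !addr0.
Qed.

(** For a symmetric bilinear map the cross terms cancel, as in the difference of two squares. *)
Lemma q_diff x y : q x x - q y y = q (x + y) (x - y).
Proof.
by rewrite q_addr q_oppr ![q (x + y) _]qC !q_addr (qC y x); rowring.
Qed.

Lemma q_lipschitz x y : l1 (q x x - q y y) <= K * (l1 x + l1 y) * l1 (x - y).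
Proof.
rewrite q_diff; apply: le_trans (q_bound _ _) _.
by rewrite ler_wpM2r ?l1_ge0 // ler_wpM2l ?l1D // ltW.
Qed.

(** Banach iteration from 0. On the ball of radius [2 * r] the quadratic term is at most
    [4 * K * r * r <= r / 4], so [T] preserves the ball, and its Lipschitz constant there is at most
    [4 * K * r <= 1 / 4]. *)
Lemma quadratic_fixed_point y : 16 * K * l1 y <= 1 ->
  exists h, l1 h <= 2 * l1 y /\ h = y - q h h.
Proof.
move=> small; set r := l1 y in small *.
have r0 : 0 <= r by apply: l1_ge0.
pose T h := y - q h h.
have Tball h : l1 h <= 2 * r -> l1 (T h) <= 2 * r.
  move=> hr; apply: le_trans (l1B _ _) _.
  have := q_bound h h; have := l1_ge0 h; rewrite -/r.
  have : K * l1 h * l1 h <= K * (2 * r) * (2 * r).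
    by rewrite ler_pM ?mulr_ge0 ?l1_ge0 ?(ltW K_gt0) // ler_wpM2l // ltW.
  have : K * r * r <= 16^-1 * r by rewrite ler_wpM2r //; lra.
  by lra.
have Tcontr h h' : l1 h <= 2 * r -> l1 h' <= 2 * r ->
    l1 (T h - T h') <= 2^-1 * l1 (h - h').
  move=> hr hr'.
  have -> : T h - T h' = - (q h h - q h' h') by rewrite /T; rowring.
  rewrite l1N; apply: le_trans (q_lipschitz _ _) _.
  rewrite ler_wpM2r ?l1_ge0 //.
  have : K * (l1 h + l1 h') <= K * (4 * r) by rewrite ler_wpM2l ?(ltW K_gt0) //; lra.
  by lra.
pose u k := iter k T 0.
have uball k : l1 (u k) <= 2 * r.
  by elim: k => [|k IH]; [rewrite /= l1_0 mulr_ge0|apply: Tball].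
have ustep (k : nat) : l1 (u k.+1 - u k) <= (2 * r) * 2^-1 ^+ k.
  elim: k => [|k IH]; first by rewrite expr0 mulr1 subr0 uball.
  by have := Tcontr _ _ (uball k.+1) (uball k); rewrite exprS; lra.
have [h Hh] := l1_geometric_limit ustep.
have hball : l1 h <= 2 * r.
  pose c := 2 * (2 * r) * n%:R.
  apply: (@le_geometric_error _ c) => k.
  have -> : h = u k - (u k - h) by rowring.
  by apply: le_trans (l1B _ _) _; apply: lerD.
(* The defect [h - T h] is compared with [T (u k)], which is [u k.+1]; both resulting distances
   decay geometrically. *)
exists h; split => //; apply/eqP; rewrite -subr_eq0; apply/eqP/l1_eq0.
pose c := 2 * (2 * (2 * r) * n%:R).
apply: (@le_geometric_error _ c) => k; rewrite add0r.
have -> : h - (y - q h h) = (T (u k) - T h) - (u k.+1 - h) by rewrite /u /= -/(u k) /T; rowring.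
apply: le_trans (l1B _ _) _.
have := Tcontr _ _ (uball k) hball; have := Hh k; have := Hh k.+1.
by have := l1_ge0 (u k - h); rewrite /c exprS; lra.
Qed.

(* The derivative of [h |-> h + q h h], as a matrix acting on row vectors. *)
Definition qjac h : 'M[R]_n := 1%:M + lin1_mx (q (h + h)).

Lemma mul_qjac x h : x *m qjac h = x + q (h + h) x.
Proof.
rewrite mulmxDr mulmx1; congr (_ + _).
pose f : {linear 'rV[R]_n -> 'rV[R]_n} :=
  HB.pack (q (h + h)) (GRing.isLinear.Build R 'rV[R]_n 'rV[R]_n _ _ (q_linear (h + h))).
exact: (mul_rV_lin1 f).
Qed.

(** A kernel vector satisfies [x = - q (h + h) x], whose norm is at most half that of [x]. *)
Lemma qjac_unit h : 4 * K * l1 h <= 1 -> qjac h \in unitmx.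
Proof.
move=> small; rewrite -row_free_unit -kermx_eq0; apply/rowV0P => x /sub_kermxP.
rewrite mul_qjac => /eqP; rewrite addr_eq0 => /eqP x_eq; apply: l1_eq0.
have : l1 x <= K * (l1 h + l1 h) * l1 x.
  rewrite {1}x_eq l1N; apply: le_trans (q_bound _ _) _.
  by rewrite ler_wpM2r ?l1_ge0 // ler_wpM2l ?l1D // ltW.
by have := l1_ge0 x; nra.
Qed.

Lemma fixed_point_lipschitz y y' h h' :
  h = y - q h h -> h' = y' - q h' h' -> 4 * K * l1 h <= 1 -> 4 * K * l1 h' <= 1 ->
  l1 (h - h') <= 2 * l1 (y - y').
Proof.
move=> eh eh' s s'.
have e : h - h' = (y - y') - (q h h - q h' h') by rewrite {1}eh {1}eh'; rowring.
have : l1 (h - h') <= l1 (y - y') + K * (l1 h + l1 h') * l1 (h - h').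
  by rewrite {1}e; apply: le_trans (l1B _ _) _; rewrite lerD2l q_lipschitz.
by have := l1_ge0 (h - h'); nra.
Qed.

(** Since the equation is quadratic, its Taylor expansion at [h'] stops at order two, and the
    remainder is exact. This yields the derivative of the solution directly. *)
Lemma fixed_point_first_order y y' h h' :
  h = y - q h h -> h' = y' - q h' h' -> qjac h' \in unitmx ->
  h - h' - (y - y') *m invmx (qjac h') = - q (h - h') (h - h') *m invmx (qjac h').
Proof.
move=> eh eh' u; apply: (can_inj (mulmxK u)).
rewrite mulmxBl !mulmxKV // mul_qjac.
have -> : y - y' = h - h' + q (h + h') (h - h') by rewrite -q_diff {1}eh {1}eh'; rowring.
have -> : q (h' + h') (h - h') = q (h + h') (h - h') - q (h - h') (h - h').
  by rewrite ![q _ (h - h')]qC -q_oppr -q_addr; congr q; rowring.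
by rowring.
Qed.

End QuadraticFixedPoint.

Lemma linear_row_expand n p (f : 'rV[R]_n -> 'rV[R]_p) x : linear f ->
  f x = \sum_i x 0 i *: f (delta_mx 0 i).
Proof.
move=> fl.
pose g : {linear 'rV[R]_n -> 'rV[R]_p} :=
  HB.pack f (GRing.isLinear.Build R 'rV[R]_n 'rV[R]_p _ _ fl).
rewrite -[f]/(g : _ -> _) {1}(row_sum_delta x) linear_sum.
by apply: eq_bigr => i _; rewrite linearZ.
Qed.

Lemma bilinear_l1_bound n (q : 'rV[R]_n -> 'rV[R]_n -> 'rV[R]_n) :
  (forall x, linear (q x)) -> (forall x y, q x y = q y x) ->
  exists2 K : R, 0 < K & forall x y, l1 (q x y) <= K * l1 x * l1 y.
Proof.
move=> ql qC.
pose K := \sum_i \sum_j l1 (q (delta_mx 0 i) (delta_mx 0 j)).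
have K0 : 0 <= K by apply: sumr_ge0 => i _; apply: sumr_ge0 => j _; apply: l1_ge0.
(* The sum over pairs of basis vectors may vanish; adding 1 makes the bound strictly positive. *)
exists (K + 1) => [|x y]; first by rewrite ltr_wpDl.
apply: (@le_trans _ _ (K * l1 x * l1 y)); last first.
  by rewrite -!mulrA ler_wpM2r ?mulr_ge0 ?l1_ge0 // lerDl.
rewrite qC (linear_row_expand x (ql y)) /K !mulr_suml; apply: le_trans (l1_sum _) _.
apply: ler_sum => i _; rewrite l1Z qC (linear_row_expand y (ql _)) !mulr_suml.
apply: le_trans (ler_wpM2l (normr_ge0 _) (l1_sum _)) _.
rewrite mulr_sumr; apply: ler_sum => j _; rewrite l1Z.
by rewrite mulrA mulrC -[leRHS]mulrA ler_wpM2l ?l1_ge0 // ler_pM // l1_entry.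
Qed.

(** * Smooth dependence of the solution *)

Section RationalBigop.
Variables (U : Mat -> Prop) (F : (Mat -> R) -> Prop).
Local Notation rational := (rational_in U F).

Lemma rational_sum (I : Type) (s : seq I) (P : pred I) (f : I -> Mat -> R) :
  (forall i, rational (f i)) -> rational (fun X => \sum_(i <- s | P i) f i X).
Proof.
move=> Hf; elim: s => [|i s IH].
  by apply: (rational_ext _ _ (fun=> 0)) (rational_const _ _ _) => X; rewrite big_nil.
case Pi: (P i); last by apply: rational_ext IH => X; rewrite big_cons Pi.
by apply: rational_ext (rational_add _ _ _ _ (Hf i) IH) => X; rewrite big_cons Pi.
Qed.

Lemma rational_prod (I : Type) (s : seq I) (P : pred I) (f : I -> Mat -> R) :
  (forall i, rational (f i)) -> rational (fun X => \prod_(i <- s | P i) f i X).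
Proof.
move=> Hf; elim: s => [|i s IH].
  by apply: (rational_ext _ _ (fun=> 1)) (rational_const _ _ _) => X; rewrite big_nil.
case Pi: (P i); last by apply: rational_ext IH => X; rewrite big_cons Pi.
by apply: rational_ext (rational_mul _ _ _ _ (Hf i) IH) => X; rewrite big_cons Pi.
Qed.

Lemma rational_scale (c : R) f : rational f -> rational (fun X => c * f X).
Proof. exact/rational_mul/rational_const. Qed.

Lemma rational_det n (A : Mat -> 'M[R]_n) :
  (forall i j, rational (fun X => A X i j)) -> rational (fun X => \det (A X)).
Proof.
move=> HA; apply: rational_sum => s; apply: rational_scale.
exact: rational_prod.
Qed.

(** The adjugate formula is rational in the entries. Agreement with [invmx] is claimed on [U] only,
    because [invmx] returns a singular matrix unchanged. *)
Lemma rational_invmx n (A : Mat -> 'M[R]_n) :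
  (forall i j, rational (fun X => A X i j)) -> (forall X, U X -> A X \in unitmx) ->
  exists B : Mat -> 'M[R]_n, (forall i j, rational (fun X => B X i j)) /\
    forall X, U X -> B X = invmx (A X).
Proof.
move=> HA uA; exists (fun X => (\det (A X))^-1 *: \adj (A X)); split=> [i j|X UX].
  apply: (rational_ext _ _ (fun X => Rinv (\det (A X)) * \adj (A X) i j)).
    by move=> X; rewrite !mxE RinvE.
  apply: rational_mul.
    apply: rational_inv => [|X UX]; first exact: rational_det.
    by apply/eqP; move: (uA X UX); rewrite unitmxE unitfE.
  apply: (rational_ext _ _ (fun X => cofactor (A X) j i)); first by move=> X; rewrite mxE.
  apply: rational_scale; apply: rational_det => k l.
  by apply: rational_ext (HA (lift j k) (lift i l)) => X; rewrite !mxE.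
by rewrite /invmx uA.
Qed.

End RationalBigop.

Section SmoothFixedPoint.
Variables (d n : nat) (q : 'rV[R]_n -> 'rV[R]_n -> 'rV[R]_n).
Variables (y : Mat -> 'rV[R]_n) (X0 : Mat).
Hypothesis q_linear : forall x, linear (q x).
Hypothesis qC : forall x y, q x y = q y x.
Hypothesis y_X0 : y X0 = 0.
Hypothesis y_cont : forall i, cont_on d (fun _ => True) (fun X => y X 0 i).
Hypothesis y_affine : forall a b p, (a < d)%N -> (b < d)%N ->
  exists e, forall X t, y (upd X a b p t) = y X + t *: e.

Lemma l1_dist_cont X : cont_on d (fun _ => True) (fun Y => l1 (y Y - y X)).
Proof.
rewrite /l1; elim: (index_enum _) => [|i s IH].
  have -> : (fun Y : Mat => \sum_(i <- [::]) `|(y Y - y X) 0 i|) = (fun=> 0).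
    by apply: functional_extensionality => Y; rewrite big_nil.
  exact: cont_on_const.
have -> : (fun Y : Mat => \sum_(i <- i :: s) `|(y Y - y X) 0 i|) =
    (fun Y => Rplus (Rabs (Rplus (y Y 0 i) (- y X 0 i)))
                     (\sum_(i <- s) `|(y Y - y X) 0 i|)).
  by apply: functional_extensionality => Y; rewrite big_cons !mxE RabsE.
apply: cont_on_add IH; apply: (cont_on_comp _ _ _ Rabs) => [|Y _]; last exact: Rcontinuity_abs.
by apply: cont_on_add; [exact: y_cont|exact: cont_on_const].
Qed.

Lemma l1_dist_small X (e : R) : 0 < e ->
  exists delta, Rlt 0 delta /\ forall Y, close d delta X Y -> l1 (y Y - y X) < e.
Proof.
move=> e0; have [delta [d0 H]] := @l1_dist_cont X X I e (elimT RltP e0).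
exists delta; split=> // Y /H; rewrite RabsE subrr l1_0 => /RltP.
by rewrite RminusE subr0 ger0_norm ?l1_ge0.
Qed.

Lemma smooth_quadratic_fixed_point :
  exists (U : Mat -> Prop) (h : Mat -> 'rV[R]_n),
  [/\ mx_open d U, U X0, h X0 = 0, forall X, U X -> h X = y X - q (h X) (h X) &
    forall f, rational_in U (fun g => exists i, g = (fun X => h X 0 i)) f ->
      smooth_real d U f].
Proof.
have [K K0 qK] := bilinear_l1_bound q_linear qC.
(* The strict inequality makes [U] open while still allowing the contraction. *)
pose U X := 16 * K * l1 (y X) < 1.
have [h Hh] : exists h : Mat -> 'rV[R]_n,
    forall X, U X -> l1 (h X) <= 2 * l1 (y X) /\ h X = y X - q (h X) (h X).
  apply: (functional_choice (fun X h =>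
    U X -> l1 h <= 2 * l1 (y X) /\ h = y X - q h h)) => X.
  (* Off [U] the solution gets the default value 0. *)
  case: (boolP (16 * K * l1 (y X) < 1)) => [UX|nU]; last by exists 0 => /negPn/negP[].
  by have [h Hh] := quadratic_fixed_point q_linear qC K0 qK (ltW UX); exists h.
have h_small X : U X -> 4 * K * l1 (h X) <= 1.
  move=> UX; have [le_h _] := Hh X UX.
  have : K * l1 (h X) <= K * (2 * l1 (y X)) by rewrite ler_wpM2l // ltW.
  by have := ltW UX; have := mulr_ge0 (ltW K0) (l1_ge0 (y X)); lra.
have h_unit X : U X -> qjac q (h X) \in unitmx.
  by move=> UX; apply: (qjac_unit q_linear K0 qK); apply: h_small.
have h_lip X Y : U X -> U Y -> l1 (h Y - h X) <= 2 * l1 (y Y - y X).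
  move=> UX UY; apply: (fixed_point_lipschitz q_linear qC K0 qK).
  - exact: (Hh Y UY).2.
  - exact: (Hh X UX).2.
  - exact: h_small.
  - exact: h_small.
have U_open : mx_open d U.
  (* [e] is the slack left at [X] in the inequality defining [U]. *)
  move=> X UX; pose e := (16 * K)^-1 - l1 (y X).
  have K16 : 0 < 16 * K by rewrite mulr_gt0.
  have e0 : 0 < e by rewrite subr_gt0 -[ltRHS]mul1r ltr_pdivlMr // mulrC.
  have [delta [d0 H]] := l1_dist_small X e0; exists delta; split=> // Y /H lt_e.
  have : l1 (y Y) <= l1 (y Y - y X) + l1 (y X) by rewrite -{1}(subrK (y X) (y Y)) l1D.
  move=> le_y; rewrite /U mulrC -ltr_pdivlMr // mul1r.
  by apply: le_lt_trans le_y _; rewrite -ltrBrDr.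
exists U, h; split=> //.
- by rewrite /U y_X0 l1_0 mulr0.
- apply: l1_eq0; have [|le_h _] := Hh X0; first by rewrite /U y_X0 l1_0 mulr0.
  by move: le_h; rewrite y_X0 l1_0 mulr0.
- by move=> X /Hh[].
move=> f; apply: rational_smooth => {f} [_ [i ->]|_ a b p [i ->] /ssrnat.ltP ad /ssrnat.ltP bd].
  move=> X UX eps /RltP eps0.
  have e0 : 0 < eps / 2 by rewrite divr_gt0.
  have [d1 [d10 H1]] := U_open X UX; have [d2 [d20 H2]] := l1_dist_small X e0.
  exists (Rmin d1 d2); split; first exact: Rmin_pos.
  move=> Y /close_min[/H1 UY /H2 lt_e]; apply/RltP; rewrite RabsE.
  apply: (@le_lt_trans _ _ (l1 (h Y - h X))).
    by have := l1_entry (h Y - h X) i; rewrite !mxE.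
  by apply: le_lt_trans (h_lip _ _ UX UY) _; rewrite mulrC -ltr_pdivlMr.
have [e He] := y_affine p ad bd.
pose F g := exists i, g = (fun X => h X 0 i).
have rat_h j : rational_in U F (fun X => h X 0 j) by apply: rational_gen; exists j.
(* By bilinearity the entries of the Jacobian are affine in the coordinates of [h X]. *)
have rat_jac j k : rational_in U F (fun X => qjac q (h X) j k).
  apply: (rational_ext _ _ (fun X => (1%:M : 'M[R]_n) j k +
      \sum_l (2 * q (delta_mx 0 j) (delta_mx 0 l) 0 k) * h X 0 l)) => [X|].
    rewrite !mxE qC (q_addr q_linear) !mxE; congr (_ + _).
    rewrite (linear_row_expand (h X) (q_linear _)) summxE -big_split /=.
    by apply: eq_bigr => l _; rewrite mxE; ring.
  apply: rational_add; first exact: rational_const.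
  by apply: rational_sum => l; apply: rational_scale.
have [B [ratB BE]] := rational_invmx rat_jac h_unit.
(* Differentiating [h + q h h = y] in the chosen direction gives the derivative of [h] times
   [qjac q h] equal to [e]; [B] inverts the Jacobian. *)
exists (fun X => (e *m B X) 0 i); split.
  apply: (rational_ext _ _ (fun X => \sum_j e 0 j * B X j i)); first by move=> X; rewrite mxE.
  by apply: rational_sum => j; apply: rational_scale.
move=> X UX; have [r [/RltP r0 Hr]] := U_open X UX.
pose D := \sum_j `|B X j i|.
have D0 : 0 <= D by apply: sumr_ge0.
(* The increment of [h] is at most [2 * l1 e] times the size of [t], so [K] times its square, times
   the column sum [D], bounds the remainder. *)
pose C := K * (2 * l1 e) * (2 * l1 e) * D.
apply: (derivable_pt_lim_quadratic_error _ _ C r); first exact/RltP.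
move=> t /RltP; rewrite RabsE upd_zero => tr; apply/RleP; rewrite RabsE.
have UY : U (upd X a b p t) by apply: Hr; apply: upd_close; apply/RltP; rewrite RabsE.
have De : y (upd X a b p t) - y X = t *: e by rewrite He addrAC subrr add0r.
have := fixed_point_first_order q_linear qC (Hh _ UY).2 (Hh X UX).2 (h_unit X UX).
rewrite De -BE // -scalemxAl; set Dh := h _ - h X.
move/rowP => /(_ i); rewrite !mxE.
have le_Dh : l1 Dh <= 2 * (`|t| * l1 e).
  by apply: le_trans (h_lip _ _ UX UY) _; rewrite De l1Z.
have le_q : l1 (q Dh Dh) <= K * (2 * l1 e) * (2 * l1 e) * (t * t).
  have -> : t * t = `|t| * `|t| by rewrite -normrM ger0_norm // sqr_ge0.
  apply: le_trans (qK Dh Dh) _.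
  have -> : K * (2 * l1 e) * (2 * l1 e) * (`|t| * `|t|) =
    K * (2 * (`|t| * l1 e)) * (2 * (`|t| * l1 e)) by ring.
  by rewrite ler_pM ?mulr_ge0 ?l1_ge0 ?(ltW K0) // ler_wpM2l // ltW.
rewrite !RminusE !RmultE [(\sum_j _) * t]mulrC => ->; apply: le_trans (ler_norm_sum _ _ _) _.
apply: (@le_trans _ _ (\sum_j l1 (q Dh Dh) * `|B X j i|)).
  apply: ler_sum => j _; rewrite normrM ler_wpM2r // mxE normrN; exact: l1_entry.
by rewrite -mulr_sumr /C mulrAC ler_wpM2r.
Qed.

End SmoothFixedPoint.

(** * The equation for the unitary factors *)

Local Open Scope complex_scope.
Local Notation Re := complex.Re.
Local Notation Im := complex.Im.

Lemma big_option (V : nmodType) (I : finType) (F : option I -> V) :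
  \sum_o F o = F None + \sum_i F (Some i).
Proof.
rewrite (perm_big (None :: map some (index_enum I))) /=; first by rewrite big_cons big_map.
apply: uniq_perm => [||o]; first exact: index_enum_uniq.
  rewrite /= map_inj_uniq ?index_enum_uniq ?andbT; last by move=> ? ? [].
  by apply/mapP => -[].
rewrite mem_index_enum; case: o => [i|//].
by rewrite inE /= map_f ?mem_index_enum.
Qed.

Lemma mxtrace_sum (V : pzSemiRingType) (I : finType) n (F : I -> 'M[V]_n) :
  \tr (\sum_i F i) = \sum_i \tr (F i).
Proof. exact: raddf_sum. Qed.

Lemma mxtraceN (V : pzRingType) n (A : 'M[V]_n) : \tr (- A) = - \tr A.
Proof. exact: raddfN. Qed.

(** * Conjugate transposes and the real trace pairing *)

Section Adjoint.
Variable K : rcfType.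
Implicit Types m n p : nat.

Lemma ReD (x y : K[i]) : Re (x + y) = Re x + Re y.
Proof. by case: x => a b; case: y. Qed.

Lemma ImD (x y : K[i]) : Im (x + y) = Im x + Im y.
Proof. by case: x => a b; case: y. Qed.

Lemma Re_sum (I : Type) (s : seq I) (P : pred I) (F : I -> K[i]) :
  Re (\sum_(i <- s | P i) F i) = \sum_(i <- s | P i) Re (F i).
Proof. exact: (big_morph _ ReD). Qed.

Lemma Re_realM (a : K) (x : K[i]) : Re (a%:C * x) = a * Re x.
Proof. by case: x => x y /=; rewrite mul0r subr0. Qed.

Lemma Im_realM (a : K) (x : K[i]) : Im (a%:C * x) = a * Im x.
Proof. by case: x => x y /=; rewrite mul0r addr0. Qed.

Lemma Re_conjc (x : K[i]) : Re x^* = Re x. Proof. by case: x. Qed.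

Definition ctr m n (A : 'M[K[i]]_(m, n)) : 'M[K[i]]_(n, m) := map_mx conjc A^T.

Lemma ctrE m n (A : 'M[K[i]]_(m, n)) i j : ctr A i j = (A j i)^*.
Proof. by rewrite !mxE. Qed.

Lemma ctrK m n (A : 'M[K[i]]_(m, n)) : ctr (ctr A) = A.
Proof. by apply/matrixP => i j; rewrite !ctrE conjcK. Qed.

Lemma ctrD m n (A B : 'M[K[i]]_(m, n)) : ctr (A + B) = ctr A + ctr B.
Proof. by apply/matrixP => i j; rewrite !mxE rmorphD. Qed.

Lemma ctrN m n (A : 'M[K[i]]_(m, n)) : ctr (- A) = - ctr A.
Proof. by apply/matrixP => i j; rewrite !mxE rmorphN. Qed.

Lemma ctr0 m n : ctr (0 : 'M[K[i]]_(m, n)) = 0.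
Proof. by apply/matrixP => i j; rewrite !mxE rmorph0. Qed.

Lemma ctr_sum (I : Type) (s : seq I) (P : pred I) m n (F : I -> 'M[K[i]]_(m, n)) :
  ctr (\sum_(i <- s | P i) F i) = \sum_(i <- s | P i) ctr (F i).
Proof. exact: (big_morph _ (@ctrD m n) (@ctr0 m n)). Qed.

Lemma ctrZ m n (a : K) (A : 'M[K[i]]_(m, n)) : ctr (a%:C *: A) = a%:C *: ctr A.
Proof. by apply/matrixP => i j; rewrite !mxE rmorphM /= oppr0. Qed.

Lemma ctr1 n : ctr (1%:M : 'M[K[i]]_n) = 1%:M.
Proof. by rewrite /ctr trmx1 map_mx1. Qed.

Lemma ctrM m n p (A : 'M[K[i]]_(m, n)) (B : 'M[K[i]]_(n, p)) :
  ctr (A *m B) = ctr B *m ctr A.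
Proof. by rewrite /ctr trmx_mul map_mxM. Qed.

Lemma Re_tr_ctr n (A : 'M[K[i]]_n) : Re (\tr (ctr A)) = Re (\tr A).
Proof. by rewrite !Re_sum; apply: eq_bigr => i _; rewrite ctrE Re_conjc. Qed.

(** The real trace pairing is the Euclidean inner product of the real and imaginary parts. *)
Lemma Re_tr_ctr_mul m n (A B : 'M[K[i]]_(m, n)) :
  Re (\tr (ctr A *m B)) =
  \sum_i \sum_j (Re (A i j) * Re (B i j) + Im (A i j) * Im (B i j)).
Proof.
rewrite Re_sum exchange_big; apply: eq_bigr => j _; rewrite mxE Re_sum.
apply: eq_bigr => i _; rewrite ctrE.
by case: (A i j) => a b; case: (B i j) => c e /=; ring.
Qed.

Lemma Re_tr_gram_ge0 m n (A : 'M[K[i]]_(m, n)) : 0 <= Re (\tr (ctr A *m A)).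
Proof.
rewrite Re_tr_ctr_mul; apply: sumr_ge0 => i _; apply: sumr_ge0 => j _.
by rewrite addr_ge0 // -expr2 sqr_ge0.
Qed.

Lemma Re_tr_gram_eq0 m n (A : 'M[K[i]]_(m, n)) : Re (\tr (ctr A *m A)) = 0 -> A = 0.
Proof.
have ge0 i j : 0 <= Re (A i j) * Re (A i j) + Im (A i j) * Im (A i j).
  by rewrite addr_ge0 // -expr2 sqr_ge0.
rewrite Re_tr_ctr_mul => /eqP; rewrite psumr_eq0 => [/allP H|i _]; last exact: sumr_ge0.
apply/matrixP => i j; rewrite mxE; have := H i (mem_index_enum _).
rewrite /= psumr_eq0 // => /allP /(_ j (mem_index_enum _)) /=.
rewrite paddr_eq0 -?expr2 ?sqr_ge0 // !sqrf_eq0 => /andP[/eqP r0 /eqP i0].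
by move: r0 i0; case: (A i j) => /= ? ? -> ->.
Qed.

(** With the next lemma this computes the transpose of the linearised equations for the real
    pairing; only the Hermitian part of the covector [C] enters. *)
Lemma Re_tr_pair_hermitization n (H C : 'M[K[i]]_n) :
  Re (\tr (ctr (H + ctr H) *m C)) = Re (\tr ((C + ctr C) *m H)).
Proof.
rewrite ctrD ctrK !mulmxDl !mxtraceD !ReD addrC.
by rewrite -[Re (\tr (ctr H *m C))]Re_tr_ctr ctrM ctrK mxtrace_mulC.
Qed.

Lemma Re_tr_pair_conjugation n (P H C : 'M[K[i]]_n) : ctr P = P ->
  Re (\tr (ctr (ctr H *m P + P *m H) *m C)) = Re (\tr ((C + ctr C) *m P *m H)).
Proof.
move=> P_herm; rewrite ctrD !ctrM ctrK P_herm !mulmxDl !mxtraceD !ReD.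
rewrite -[Re (\tr (ctr H *m P *m C))]Re_tr_ctr !ctrM ctrK P_herm mulmxA.
by rewrite mxtrace_mulC mulmxA.
Qed.

End Adjoint.

(** * Real coordinates of tuples of complex matrices *)

Section RealCoordinates.
Variables (K : rcfType) (O : finType) (d : nat).
Local Notation coord := (O * 'I_d * 'I_d * bool)%type.
Definition ncoord : nat := #|{: coord}|.
Local Notation N := ncoord.
Implicit Types Z W : O -> 'M[K[i]]_d.

Definition component (z : K[i]) (p : bool) : K := if p then Re z else Im z.

(** Conjugation makes the equations linear over the reals only, so tuples are flattened into real
    row vectors to which matrix rank arguments apply. *)
Definition vec Z : 'rV[K]_N :=
  \row_j let: (o, a, b, p) := enum_val j in component (Z o a b) p.

Definition unvec (x : 'rV[K]_N) (o : O) : 'M[K[i]]_d :=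
  \matrix_(a, b) (x 0 (enum_rank (o, a, b, true)) +i* x 0 (enum_rank (o, a, b, false))).

Lemma vecE Z o a b p : vec Z 0 (enum_rank (o, a, b, p)) = component (Z o a b) p.
Proof. by rewrite mxE enum_rankK. Qed.

Lemma unvecK Z o : unvec (vec Z) o = Z o.
Proof. by apply/matrixP => a b; rewrite mxE !vecE; case: (Z o a b). Qed.

Lemma vecK (x : 'rV[K]_N) : vec (unvec x) = x.
Proof.
apply/rowP => j; rewrite -[j]enum_valK; case: (enum_val j) => [[[o a] b] p].
by rewrite vecE mxE; case: p.
Qed.

Lemma eq_vec Z W : (forall o, Z o = W o) -> vec Z = vec W.
Proof. by move=> E; apply/rowP => j; rewrite !mxE; case: enum_val => [[[o a] b] p]; rewrite E. Qed.

Lemma vec_inj Z W : vec Z = vec W -> forall o, Z o = W o.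
Proof. by move=> E o; rewrite -unvecK E unvecK. Qed.

Lemma vec_linear (a : K) Z W : vec (fun o => a%:C *: Z o + W o) = a *: vec Z + vec W.
Proof.
apply/rowP => j; rewrite !mxE; case: enum_val => [[[o b] c] p].
by case: p; rewrite /component !mxE ?ReD ?ImD ?Re_realM ?Im_realM.
Qed.

Lemma unvec_linear (a : K) (x y : 'rV[K]_N) :
  unvec (a *: x + y) = fun o => a%:C *: unvec x o + unvec y o.
Proof.
apply: functional_extensionality => o; apply/matrixP => b c; rewrite !mxE.
apply/eqP; rewrite eq_complex /=.
by rewrite !mul0r subr0 addr0 !eqxx.
Qed.

Lemma vec_pairing Z W :
  vec Z *m (vec W)^T = (\sum_o Re (\tr (ctr (Z o) *m W o)))%:M.
Proof.
apply/matrixP => i j; rewrite !ord1 !mxE eqxx mulr1n.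
rewrite (reindex enum_rank) /=; last exact/onW_bij/enum_rank_bij.
rewrite (eq_bigr (fun u : coord => component (Z u.1.1.1 u.1.1.2 u.1.2) u.2 *
  component (W u.1.1.1 u.1.1.2 u.1.2) u.2)); last first.
  by move=> [[[o a] b] p] _; rewrite [in X in _ * X]mxE !vecE.
rewrite -(pair_bigA _ (fun (t : O * 'I_d * 'I_d) p =>
  component (Z t.1.1 t.1.2 t.2) p * component (W t.1.1 t.1.2 t.2) p)) /=.
rewrite -(pair_bigA _ (fun (t : O * 'I_d) b => \sum_p
  component (Z t.1 t.2 b) p * component (W t.1 t.2 b) p)) /=.
rewrite -(pair_bigA _ (fun o a => \sum_b \sum_p
  component (Z o a b) p * component (W o a b) p)) /=.
apply: eq_bigr => o _; rewrite Re_tr_ctr_mul.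
by apply: eq_bigr => a _; apply: eq_bigr => b _; rewrite big_bool.
Qed.

End RealCoordinates.

(** * Solvability of the linearised equation and the quadratic fixed point *)

Section UnitaryPerturbation.
Variables (K : rcfType) (m d : nat) (P : 'I_m -> 'M[K[i]]_d).
Hypothesis P_herm : forall i, ctr (P i) = P i.
Hypothesis P_irr : forall A, (forall i, A *m P i = P i *m A) -> exists c, A = c%:M.
Implicit Types (h g : 'I_m -> 'M[K[i]]_d) (Z C : option 'I_m -> 'M[K[i]]_d).

(* For [W i = 1 + h i], the system [W i W i^* = 1, sum_i W i^* P i W i = S] reads
   [linear_part h + quadratic_part h h = (0, S - sum_i P i)], the index [None]
   standing for the last equation. *)
Definition linear_part h (o : option 'I_m) : 'M[K[i]]_d :=
  if o is Some i then h i + ctr (h i) else \sum_i (ctr (h i) *m P i + P i *m h i).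

(** This is the polarised form of the second-order terms: the fixed-point argument needs a symmetric
    bilinear map, and the factor one half restores those terms on the diagonal. *)
Definition quadratic_part h g (o : option 'I_m) : 'M[K[i]]_d :=
  (2^-1)%:C *:
  if o is Some i then h i *m ctr (g i) + g i *m ctr (h i)
  else \sum_i (ctr (h i) *m P i *m g i + ctr (g i) *m P i *m h i).

Lemma linear_part_linear (a : K) h g o :
  linear_part (fun i => a%:C *: h i + g i) o =
  a%:C *: linear_part h o + linear_part g o.
Proof.
case: o => [i|] /=; first by rewrite ctrD ctrZ scalerDr addrACA.
rewrite scaler_sumr -big_split; apply: eq_bigr => i _ /=.
by rewrite ctrD ctrZ mulmxDl mulmxDr -scalemxAl -scalemxAr scalerDr addrACA.
Qed.

Lemma quadratic_part_linear (a : K) h g g' o :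
  quadratic_part h (fun i => a%:C *: g i + g' i) o =
  a%:C *: quadratic_part h g o + quadratic_part h g' o.
Proof.
rewrite /quadratic_part scalerA mulrC -scalerA -scalerDr; congr (_ *: _).
case: o => [i|] /=.
  by rewrite ctrD ctrZ mulmxDl mulmxDr -scalemxAl -scalemxAr scalerDr addrACA.
rewrite scaler_sumr -big_split; apply: eq_bigr => i _ /=.
by rewrite ctrD ctrZ !mulmxDl mulmxDr -!scalemxAl -scalemxAr scalerDr addrACA.
Qed.

Lemma quadratic_partC h g o : quadratic_part h g o = quadratic_part g h o.
Proof.
congr (_ *: _); case: o => [i|]; first exact: addrC.
by apply: eq_bigr => i _; rewrite addrC.
Qed.

Lemma quadratic_part_diag h o : quadratic_part h h o =
  if o is Some i then h i *m ctr (h i) else \sum_i ctr (h i) *m P i *m h i.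
Proof.
have half (A : 'M[K[i]]_d) : (2^-1)%:C *: (A + A) = A.
  rewrite -[A + A]mulr2n -scaler_nat scalerA -(rmorph_nat (real_complex K)) -rmorphM.
  by rewrite mulVf ?pnatr_eq0 // rmorph1 scale1r.
rewrite /quadratic_part; case: o => [i|]; first exact: half.
by rewrite big_split half.
Qed.

Definition linear_mx : 'M[K]_(ncoord 'I_m d, ncoord (option 'I_m) d) :=
  lin1_mx (fun x => vec (linear_part (unvec x))).

Lemma mul_linear_mx x : x *m linear_mx = vec (linear_part (unvec x)).
Proof.
have fl : linear (fun x : 'rV[K]_(ncoord 'I_m d) =>
    vec (linear_part (unvec x))).
  move=> a u w; rewrite -vec_linear; apply: eq_vec => o.
  by rewrite unvec_linear linear_part_linear.
pose f : {linear _ -> _} := HB.pack (fun x => vec (linear_part (unvec x)))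
  (GRing.isLinear.Build K _ _ _ _ fl).
exact: (mul_rV_lin1 f).
Qed.

(** By duality it suffices that every column of the cokernel matrix annihilates [vec Z].
    Irreducibility leaves, after hermitization, only the covectors expressing the trace
    condition. *)
Lemma linear_part_range Z : (forall o, ctr (Z o) = Z o) ->
  \tr (Z None) = \sum_i \tr (P i *m Z (Some i)) -> (vec Z <= linear_mx)%MS.
Proof.
move=> Zherm Ztr; rewrite submxE; apply/eqP/matrixP => i0 j; rewrite [RHS]mxE.
suff: col j (vec Z *m cokermx linear_mx) = 0 by move/colP/(_ i0); rewrite !mxE.
(* [c] is a covector killing the range; it is read back as a tuple of matrices [C]. *)
rewrite colE -mulmxA -colE; set c := col j _.
have Lc : linear_mx *m c = 0 by rewrite /c colE mulmxA mulmx_coker mul0mx.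
pose C := unvec c^T; have cE : c = (vec C)^T by rewrite vecK trmxK.
pose B := C None + ctr (C None).
pose G i := C (Some i) + ctr (C (Some i)) + B *m P i.
have annihilates h : \sum_i Re (\tr (G i *m h i)) = 0.
  have : vec h *m linear_mx *m c = 0 by rewrite -mulmxA Lc mulmx0.
  rewrite mul_linear_mx cE vec_pairing => /matrixP/(_ 0 0).
  rewrite !mxE eqxx mulr1n big_option => E.
  rewrite -[RHS]E /= ctr_sum mulmx_suml mxtrace_sum Re_sum -big_split.
  apply: eq_bigr => i _ /=; rewrite unvecK.
  by rewrite Re_tr_pair_conjugation // Re_tr_pair_hermitization mulmxDl mxtraceD ReD addrC.
(* Testing with [ctr (G i)] turns the vanishing pairing into a sum of squared norms. *)
have G0 i : G i = 0.
  have := annihilates (fun i => ctr (G i)) => /eqP.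
  have gram k : Re (\tr (G k *m ctr (G k))) = Re (\tr (ctr (ctr (G k)) *m ctr (G k))).
    by rewrite ctrK.
  rewrite psumr_eq0 => [/allP /(_ i (mem_index_enum _)) /eqP|k _]; rewrite gram.
    by move/Re_tr_gram_eq0 => G0; rewrite -[G i]ctrK G0 ctr0.
  exact: Re_tr_gram_ge0.
have BP i : B *m P i = - (C (Some i) + ctr (C (Some i))).
  by apply/eqP; rewrite -addr_eq0 addrC; apply/eqP/G0.
(* [B] and [P i] are Hermitian, and so is their product by [BP]; hence they commute. *)
have [b Bb] : exists b, B = b%:M.
  apply: P_irr => i; rewrite BP -[P i]P_herm -[B]ctrK -ctrM.
  have -> : ctr B = B by rewrite /B ctrD ctrK addrC.
  by rewrite BP ctrN ctrD ctrK addrC.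
rewrite cE vec_pairing; apply/matrixP => k l; rewrite !mxE.
suff -> : \sum_o Re (\tr (ctr (Z o) *m C o)) = 0 by rewrite mul0rn.
(* Against a Hermitian [Z o] only the Hermitian part of [C o] counts. *)
have dbl o : Re (\tr (Z o *m (C o + ctr (C o)))) = Re (\tr (ctr (Z o) *m C o)) *+ 2.
  rewrite mulmxDr mxtraceD ReD Zherm mulr2n -[in X in _ + X](Zherm o) -ctrM Re_tr_ctr.
  by rewrite mxtrace_mulC.
(* The hermitized components are [b] at [None] and [- b] times [P i] at [Some i], so the doubled
   pairing is the real part of [b] times the difference of the two sides of the trace hypothesis. *)
have : (\sum_o Re (\tr (ctr (Z o) *m C o))) *+ 2 = 0.
  rewrite -sumrMnl (eq_bigr _ (fun o _ => esym (dbl o))) big_option -/B Bb.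
  rewrite mul_mx_scalar mxtraceZ Ztr -Re_sum -ReD mulr_sumr -big_split big1 // => i _ /=.
  rewrite -[C _ + _]opprK -BP Bb mul_scalar_mx mulmxN mxtraceN -scalemxAr mxtraceZ.
  by rewrite mxtrace_mulC subrr.
by move/eqP; rewrite mulrn_eq0 => /eqP.
Qed.

Definition target S (o : option 'I_m) : 'M[K[i]]_d :=
  if o is None then S - \sum_i P i else 0.

(** [pinvmx linear_mx] inverts [linear_mx] from the right only on its row space. Applied separately
    to target and quadratic part it gives the fixed-point form; only their difference at a solution
    must lie in the range. *)
Definition quadratic_map x w : 'rV[K]_(ncoord 'I_m d) :=
  vec (quadratic_part (unvec x) (unvec w)) *m pinvmx linear_mx.

Definition target_map S : 'rV[K]_(ncoord 'I_m d) :=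
  vec (target S) *m pinvmx linear_mx.

Lemma quadratic_map_linear x : linear (quadratic_map x).
Proof.
move=> a u w; rewrite /quadratic_map scalemxAl -mulmxDl -vec_linear unvec_linear.
by congr (_ *m _); apply: eq_vec => o; apply: quadratic_part_linear.
Qed.

Lemma quadratic_mapC x w : quadratic_map x w = quadratic_map w x.
Proof. exact: (congr1 (mulmx^~ _) (eq_vec (quadratic_partC (unvec x) (unvec w)))). Qed.

Definition direction E (o : option 'I_m) : 'M[K[i]]_d := if o is None then E else 0.

Lemma target_map_affine E : exists e, forall S t,
  target_map (t%:C *: E + S) = t *: e + target_map S.
Proof.
exists (vec (direction E) *m pinvmx linear_mx) => S t.
rewrite /target_map scalemxAl -mulmxDl -vec_linear; congr (_ *m _).
by apply: eq_vec => -[i|] /=; rewrite ?scaler0 ?addr0 // addrA.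
Qed.

Lemma target_map_eq0 : target_map (\sum_i P i) = 0.
Proof.
rewrite /target_map (_ : vec _ = 0) ?mul0mx //.
by rewrite -[RHS]vecK; apply: eq_vec => -[i|] /=; apply/matrixP => a b; rewrite ?subrr !mxE.
Qed.

Lemma fixed_point_solves S x : ctr S = S -> \tr S = \tr (\sum_i P i) ->
  x = target_map S - quadratic_map x x ->
  (forall i, (1%:M + unvec x i) *m ctr (1%:M + unvec x i) = 1%:M) /\
  \sum_i ctr (1%:M + unvec x i) *m P i *m (1%:M + unvec x i) = S.
Proof.
move=> Sherm Str x_eq; set h := unvec x.
pose Z o := (-1)%:C *: quadratic_part h h o + target S o.
have ZE o : Z o = target S o - quadratic_part h h o.
  by rewrite /Z rmorphN1 scaleN1r addrC.
have xE : x = vec Z *m pinvmx linear_mx.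
  by rewrite vec_linear scaleN1r addrC mulmxBl.
have Q_herm o : ctr (quadratic_part h h o) = quadratic_part h h o.
  rewrite quadratic_part_diag; case: o => [i|]; first by rewrite ctrM ctrK.
  by rewrite ctr_sum; apply: eq_bigr => i _; rewrite !ctrM ctrK P_herm mulmxA.
have S0_herm : ctr (\sum_i P i) = \sum_i P i.
  by rewrite ctr_sum; apply: eq_bigr => i _.
have Zherm o : ctr (Z o) = Z o.
  rewrite ZE ctrD ctrN Q_herm; case: o => [i|] /=; first by rewrite ctr0.
  by rewrite ctrD ctrN Sherm S0_herm.
(* As [S] has the trace of the sum of the [P i], the target contributes nothing, and the quadratic
   terms match by cyclicity of the trace. *)
have Ztr : \tr (Z None) = \sum_i \tr (P i *m Z (Some i)).
  rewrite ZE quadratic_part_diag mxtraceD mxtraceN mxtraceD mxtraceN Str subrr add0r.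
  rewrite mxtrace_sum -sumrN; apply: eq_bigr => i _.
  rewrite ZE quadratic_part_diag sub0r mulmxN mxtraceN; congr (- _).
  by rewrite -mulmxA mxtrace_mulC mulmxA.
have LZ : forall o, linear_part h o = Z o.
  by apply: vec_inj; rewrite -mul_linear_mx xE mulmxKpV // linear_part_range.
split=> [i|].
  have := LZ (Some i); rewrite ZE quadratic_part_diag /= sub0r => hi.
  rewrite ctrD ctr1 mulmxDl mul1mx mulmxDr mulmx1 -addrA.
  by rewrite [ctr (h i) + _]addrCA [h i + (_ + _)]addrA hi addNr addr0.
have := LZ None; rewrite ZE quadratic_part_diag /= => hN.
transitivity (\sum_i P i + \sum_i (ctr (h i) *m P i + P i *m h i) +
  \sum_i ctr (h i) *m P i *m h i).
  rewrite -!big_split; apply: eq_bigr => i _ /=.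
  rewrite ctrD ctr1 !mulmxDl !mulmxDr !mul1mx !mulmx1 -!addrA.
  by congr (_ + _); rewrite addrCA.
by rewrite hN -addrA subrK addrC subrK.
Qed.

End UnitaryPerturbation.

(** * Complex matrices over pairs of reals *)

Definition toC (z : Defs.C) : R[i] := Complex z.1 z.2.
Definition ofC (z : R[i]) : Defs.C := (Re z, Im z).

Lemma toCK : cancel toC ofC. Proof. by case. Qed.
Lemma ofCK : cancel ofC toC. Proof. by case. Qed.

Lemma toC_mul x y : toC (Cmul x y) = toC x * toC y.
Proof. by []. Qed.

Lemma toC_sum n f : toC (Csum n f) = \sum_(l < n) toC (f l).
Proof. by elim: n => [|n IH]; rewrite ?big_ord0 // big_ord_recr /= -IH. Qed.

Definition toM p q (A : Mat) : 'M[R[i]]_(p, q) := \matrix_(a, b) toC (A a b).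

Definition ofM n (M : 'M[R[i]]_n) : Mat := fun a b =>
  if (insub a, insub b) is (Some a', Some b') then ofC (M a' b') else C0.

Lemma ofME n (M : 'M[R[i]]_n) (a b : 'I_n) : ofM M a b = ofC (M a b).
Proof. by rewrite /ofM !valK. Qed.

Lemma ofMK n (M : 'M[R[i]]_n) : toM n n (ofM M) = M.
Proof. by apply/matrixP => a b; rewrite mxE ofME ofCK. Qed.

Lemma meqP p q A B : meq p q A B <-> toM p q A = toM p q B.
Proof.
split=> [E|E a b /ssrnat.ltP ap /ssrnat.ltP bq].
  by apply/matrixP => a b; rewrite !mxE E //; apply/ssrnat.ltP.
by move/matrixP: E => /(_ (Ordinal ap) (Ordinal bq)); rewrite !mxE => /(can_inj toCK).
Qed.

Lemma toM_mul p q r A B : toM p r (mmul q A B) = toM p q A *m toM q r B.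
Proof. by apply/matrixP => a b; rewrite !mxE toC_sum; apply: eq_bigr => l _; rewrite !mxE. Qed.

Lemma toM_adj p q A : toM q p (adj A) = ctr (toM p q A).
Proof. by apply/matrixP => a b; rewrite !mxE. Qed.

Lemma toM_scalar n z : toM n n (Defs.scalar_mx z) = (toC z)%:M.
Proof.
apply/matrixP => a b; rewrite !mxE /Defs.scalar_mx.
case: (PeanoNat.Nat.eq_dec a b) => [/val_inj ->|ne]; first by rewrite eqxx mulr1n.
by case: eqP => [E|_]; [case: ne; rewrite E|rewrite mulr0n].
Qed.

Lemma toM_idm n : toM n n idm = 1%:M. Proof. exact: toM_scalar. Qed.

Lemma toM_RSop m d k V : toM d d (RSop m k V) =
  \sum_(i < m) ctr (toM (k i) d (V i)) *m toM (k i) d (V i).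
Proof.
apply/matrixP => a b; rewrite mxE summxE toC_sum; apply: eq_bigr => i _.
by rewrite -toM_adj -toM_mul mxE.
Qed.

Lemma toC_mtrace d A : toC (mtrace d A) = \tr (toM d d A).
Proof. by rewrite toC_sum; apply: eq_bigr => a _; rewrite mxE. Qed.

Lemma invertibleP d A : Defs.invertible d A <-> toM d d A \in unitmx.
Proof.
split=> [[B [/meqP]]|uA]; first by rewrite toM_mul toM_idm => /mulmx1_unit[].
exists (ofM (invmx (toM d d A))); split; apply/meqP; rewrite toM_mul toM_idm ofMK.
  exact: mulmxV.
exact: mulVmx.
Qed.

Lemma hermitianP d A : Defs.hermitian d A <-> ctr (toM d d A) = toM d d A.
Proof. by rewrite -toM_adj; split=> [/meqP|E]; [|apply/meqP]. Qed.

Definition toV d (x : nat -> Defs.C) : 'cV[R[i]]_d := \col_a toC (x a).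

Lemma toC_qform d A x :
  toC (qform d A x) = \tr (ctr (toV d x) *m (toM d d A *m toV d x)).
Proof.
rewrite /mxtrace big_ord1 mxE toC_sum; apply: eq_bigr => a _.
rewrite !mxE toC_mul toC_sum; congr (_ * _).
by apply: eq_bigr => b _; rewrite !mxE.
Qed.

(** A nonzero row vector [v] in the left kernel would make the quadratic form vanish at [ctr v]. *)
Lemma pos_def_unitmx d A : pos_def d A -> toM d d A \in unitmx.
Proof.
move=> [/hermitianP herm pos]; rewrite -row_free_unit -kermx_eq0.
apply/rowV0P => v /sub_kermxP vA.
pose x a := if insub a is Some a' then ofC (ctr v a' 0) else C0.
have xE : toV d x = ctr v.
  by apply/colP => a; rewrite mxE /x valK ofCK.
apply/eqP; apply: contraT => v0; exfalso.
have /RltP : Rlt 0 (fst (qform d A x)).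
  apply: pos; have /rV0Pn[a va] := v0.
  exists a; split; first exact/ssrnat.ltP.
  move=> xa; case/negP: va; have /colP/(_ a) := xE; rewrite !mxE xa => /esym/eqP.
  by rewrite conjc_eq0.
rewrite -[fst _]/(Re (toC _)) toC_qform xE ctrK mulmxA vA mul0mx mxtrace0.
by rewrite ltxx.
Qed.

(** The quadratic form at [x] is the sum of the squared norms of the [V i] applied to [x]; if it
    vanishes, the invertible operator kills [x]. *)
Lemma pos_def_RSop m d k V : Defs.invertible d (RSop m k V) -> pos_def d (RSop m k V).
Proof.
move=> /invertibleP uS; split.
  apply/hermitianP; rewrite toM_RSop ctr_sum; apply: eq_bigr => i _.
  by rewrite ctrM ctrK.
move=> x [a [/ssrnat.ltP ad xa]]; apply/RltP.
have qE : (qform d (RSop m k V) x).1 = \sum_(i < m)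
    Re (\tr (ctr (toM (k i) d (V i) *m toV d x) *m (toM (k i) d (V i) *m toV d x))).
  rewrite -[LHS]/(Re (toC _)) toC_qform toM_RSop mulmx_suml mulmx_sumr mxtrace_sum Re_sum.
  by apply: eq_bigr => i _; rewrite ctrM !mulmxA.
rewrite qE lt_def sumr_ge0 ?andbT => [|i _]; last exact: Re_tr_gram_ge0.
apply/eqP => /eqP; rewrite psumr_eq0 => [/allP Z|i _]; last exact: Re_tr_gram_ge0.
have Vx i : toM (k i) d (V i) *m toV d x = 0 :> 'cV_(k (i : 'I_m)).
  by apply: Re_tr_gram_eq0; apply/eqP/Z/mem_index_enum.
have : toM d d (RSop m k V) *m toV d x = 0.
  by rewrite toM_RSop mulmx_suml big1 // => i _; rewrite -mulmxA Vx mulmx0.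
move/(congr1 (mulmx (invmx (toM d d (RSop m k V))))); rewrite mulKmx // mulmx0.
by move/colP/(_ (Ordinal ad)); rewrite !mxE -[0]/(toC C0) => /(can_inj toCK).
Qed.

Lemma mtrace_RSop m d k v V : in_Pv m d k v V -> (0 < m)%N ->
  mtrace d (RSop m k V) = RtoC (sum_f_R0 (fun i => Rmult (pow (v i) 2) (INR (k i))) (m - 1)).
Proof.
move=> [_ Vv] m0; apply: (can_inj toCK); rewrite toC_mtrace toM_RSop mxtrace_sum.
(* [sum_f_R0] includes its upper index, so the bound [m - 1] gives [m] terms because [m] is
   positive. *)
rewrite -[RHS]/((_ : R)%:C) RealsE subn1 prednK // big_mkord rmorph_sum.
apply: eq_bigr => i _; rewrite mxtrace_mulC -toM_adj -toM_mul.
have /meqP -> := Vv i (elimT ssrnat.ltP (ltn_ord i)).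
by rewrite toM_scalar mxtrace_scalar !RealsE mulr_natr rmorphMn.
Qed.


Definition unit_direction (p : bool) : R[i] := if p then 1 else 'i.

Lemma toM_upd d X (a b : 'I_d) p (t : R) :
  toM d d (upd X a b p t) = t%:C *: (unit_direction p *: delta_mx a b) + toM d d X.
Proof.
apply/matrixP => i j; rewrite !mxE /upd.
have -> : Nat.eqb i a && Nat.eqb j b = (i == a) && (j == b).
  by congr (_ && _); apply/PeanoNat.Nat.eqb_spec/eqP => [/val_inj|->].
case: andP => _; last by rewrite !mulr0 add0r.
rewrite mulr1 /unit_direction; apply/eqP; rewrite eq_complex.
by case: p => /=; apply/andP; split; apply/eqP; rewrite ?RplusE; ring.
Qed.

Lemma entry_cont d (a b : 'I_d) p :
  cont_on d (fun=> True) (fun X => component (toC (X a b)) p).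
Proof.
move=> X _ eps eps0; exists eps; split=> // Y /(_ a b).
by move=> /(_ (elimT ssrnat.ltP (ltn_ord a)) (elimT ssrnat.ltP (ltn_ord b)))[]; case: p.
Qed.

(** * Construction of the local cross section *)

Section CrossSection.
Variables (m d : nat) (k : nat -> nat) (v : nat -> R) (V : system).
Hypothesis m_gt0 : (0 < m)%coq_nat.
Hypothesis V_Pv : in_Pv m d k v V.
Hypothesis V_irr : irreducible m d k V.

Let VM (i : 'I_m) : 'M[R[i]]_(k i, d) := toM (k i) d (V i).
Let P (i : 'I_m) : 'M[R[i]]_d := ctr (VM i) *m VM i.

Lemma RSop_sum : toM d d (RSop m k V) = \sum_i P i.
Proof. exact: toM_RSop. Qed.

Lemma P_herm i : ctr (P i) = P i.
Proof. by rewrite ctrM ctrK. Qed.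

Lemma P_irr (A : 'M[R[i]]_d) : (forall i, A *m P i = P i *m A) -> exists c, A = c%:M.
Proof.
move=> AP; have [|c /meqP] := V_irr (A := ofM A); last first.
  by rewrite ofMK toM_scalar; exists (toC c).
move=> i /ssrnat.ltP im; apply/meqP; rewrite !toM_mul toM_adj ofMK.
exact: (AP (Ordinal im)).
Qed.

Definition section_target (X : Mat) := target_map P (toM d d X).

Lemma section_target_cont i :
  cont_on d (fun=> True) (fun X => section_target X 0 i).
Proof.
pose F f := exists (a b : 'I_d) p, f = (fun X : Mat => component (toC (X a b)) p).
apply: (@rational_cont d _ F) => [f [a [b [p ->]]]|]; first exact: entry_cont.
apply: (rational_ext _ _ (fun X => \sum_j
  pinvmx (linear_mx P) j i * vec (target P (toM d d X)) 0 j)).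
  by move=> X; rewrite mxE; apply: eq_bigr => j _; rewrite mulrC.
apply: rational_sum => j; apply: rational_scale.
case E: (enum_val j) => [[[[o|] a] b] p].
  apply: (rational_ext _ _ (fun=> 0)); last exact: rational_const.
  by move=> X; rewrite mxE E /= mxE; case: p E.
apply: (rational_ext _ _ (fun X =>
  Rplus (component (toC (X a b)) p) (component (- (\sum_i P i) a b) p))).
  by move=> X; rewrite mxE E /= !mxE; case: p E => _; rewrite /component ?ReD ?ImD.
by apply: rational_add; [apply: rational_gen; exists a, b, p|exact: rational_const].
Qed.

Lemma section_target_affine a b p : (a < d)%N -> (b < d)%N ->
  exists e, forall X t, section_target (upd X a b p t) = section_target X + t *: e.
Proof.
move=> ad bd.
have [e He] := target_map_affine P (unit_direction p *: delta_mx (Ordinal ad) (Ordinal bd)).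
exists e => X t; rewrite addrC -He; congr (target_map _ _).
exact: (@toM_upd d X (Ordinal ad) (Ordinal bd)).
Qed.

Lemma local_cross_section : exists (A : Mat -> Prop) (rho : Mat -> system),
  let tau := sum_f_R0 (fun i => Rmult (pow (v i) 2) (INR (k i))) (m - 1) in
  (forall S, A S -> in_Glpos_tau d tau S) /\
  (exists U : Mat -> Prop, mx_open d U /\ forall S, A S <-> (U S /\ in_Glpos_tau d tau S)) /\
  A (RSop m k V) /\
  (forall S, A S -> in_Pv m d k v (rho S)) /\
  smooth_sys_on_subset d m k A rho /\
  (forall S, A S -> meq d d (RSop m k (rho S)) S) /\
  (forall i, (i < m)%coq_nat -> meq (k i) d (rho (RSop m k V) i) (V i)).
Proof.
set tau := sum_f_R0 _ _.
have [|U [h [U_open U0 h0 hE hsmooth]]] := @smooth_quadratic_fixed_point d _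
  (quadratic_map P) section_target (RSop m k V) (quadratic_map_linear P)
  (quadratic_mapC P) _ section_target_cont section_target_affine.
  by rewrite /section_target RSop_sum target_map_eq0.
pose W X (i : 'I_m) : 'M[R[i]]_d := 1%:M + unvec (h X) i.
(* Indices outside the system keep the arbitrary default [V i]. *)
pose rho X (i : nat) : Mat :=
  if insub i is Some i' then mmul d (V i) (ofM (W X i')) else V i.
have rhoE X (i : 'I_m) : rho X i = mmul d (V i) (ofM (W X i)) by rewrite /rho valK.
have rhoM X (i : 'I_m) : toM (k i) d (rho X i) = VM i *m W X i.
  by rewrite rhoE toM_mul ofMK.
have tr_RSop := mtrace_RSop V_Pv (introT ssrnat.ltP m_gt0); rewrite -/tau in tr_RSop.
have solved S : U S -> in_Glpos_tau d tau S ->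
    (forall i, W S i *m ctr (W S i) = 1%:M) /\ toM d d (RSop m k (rho S)) = toM d d S.
  move=> US [[/hermitianP herm _] tr].
  have [|||WW SW] := @fixed_point_solves _ _ _ P P_herm P_irr (toM d d S) (h S).
  - exact: herm.
  - by rewrite -RSop_sum -!toC_mtrace tr tr_RSop.
  - exact: hE.
  split=> //; rewrite -SW toM_RSop; apply: eq_bigr => i _.
  by rewrite rhoM ctrM !mulmxA.
exists (fun S => U S /\ in_Glpos_tau d tau S), rho.
split; first by move=> S [].
split; first by exists U.
split.
  by split=> //; split=> //; apply: pos_def_RSop; case: V_Pv.
split.
  move=> S [US GS]; have [WW SE] := solved S US GS; split.
    by apply/invertibleP; rewrite SE; apply: pos_def_unitmx; case: GS.
  move=> i /ssrnat.ltP im; apply/meqP.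
  (* The unitary factor cancels in [VM i *m W S i *m ctr (W S i) *m ctr (VM i)], so the weight is
     that of [V]. *)
  have /meqP := V_Pv.2 i (elimT ssrnat.ltP im) => <-.
  rewrite !toM_mul !toM_adj (rhoM S (Ordinal im)) ctrM -mulmxA [W _ _ *m _]mulmxA.
  by rewrite WW mul1mx.
split; last split.
(* The formula for [rho] is rational in [h] on all of [U], without trace or positivity constraints,
   so [rho] is its own smooth extension. *)
- move=> S [US _]; exists U; split=> //; split=> //; exists rho; split=> // i r c.
  move=> /ssrnat.ltP im _ /ssrnat.ltP cd; pose i' := Ordinal im.
  have rat : rational_C U (fun g => exists i, g = (fun X => h X 0 i))
      (fun X => rho X i r c).
    have -> : (fun X => rho X i r c) =
        fun X => Csum d (fun l => Cmul (V i r l) (ofM (W X i') l c)).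
      by apply: functional_extensionality => X; rewrite (rhoE X i').
    apply: rational_C_sum => l; apply: rational_C_mul; first exact: rational_C_const.
    (* [rational_C_sum] asks for every natural [l]; beyond [d] the entry of [ofM] is the default
       [C0]. *)
    case ld: (l < d)%N; last first.
      have -> : (fun X => ofM (W X i') l c) = fun=> C0.
        by apply: functional_extensionality => X; rewrite /ofM insubF.
      exact: rational_C_const.
    have E X : ofM (W X i') l c = ofC (W X i' (Ordinal ld) (Ordinal cd)).
      exact: (ofME (W X i') (Ordinal ld) (Ordinal cd)).
    split; [apply: (rational_ext _ _ (fun X =>
        Rplus (Re ((1%:M : 'M[R[i]]_d) (Ordinal ld) (Ordinal cd)))
              (h X 0 (enum_rank (i', Ordinal ld, Ordinal cd, true)))))
      |apply: (rational_ext _ _ (fun X =>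
        Rplus (Im ((1%:M : 'M[R[i]]_d) (Ordinal ld) (Ordinal cd)))
              (h X 0 (enum_rank (i', Ordinal ld, Ordinal cd, false)))))];
      do ?[by move=> X; rewrite E /= /W !mxE ?ReD ?ImD];
      (apply: rational_add; [exact: rational_const|apply: rational_gen]);
      by eexists; reflexivity.
  by case: rat => r1 r2; split; apply: hsmooth.
- by move=> S [US GS]; apply/meqP; case: (solved S US GS).
- move=> i /ssrnat.ltP im; apply/meqP; rewrite (rhoM _ (Ordinal im)) /W h0.
  rewrite (_ : unvec _ _ = 0) ?addr0 ?mulmx1 //.
  by apply/matrixP => a b; rewrite !mxE.
Qed.

End CrossSection.

End MatrixEquation.

Theorem theorem4p8 (m d : nat) (k : nat -> nat) (v : nat -> R) (tau : R)
  (V : system)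
  (hm : (1 <= m)%nat) (hd : (1 <= d)%nat)
  (hk : forall i, (i < m)%nat -> (1 <= k i)%nat /\ (k i <= d)%nat)
  (hv : forall i, (i < m)%nat -> 0 < v i)
  (htau : tau = sum_f_R0 (fun i => v i ^ 2 * INR (k i)) (m - 1))
  (hV : in_Pv m d k v V)
  (hirr : irreducible m d k V) :
  exists (A : Mat -> Prop) (rho : Mat -> system),
    (* A is an open neighbourhood of S_V in Gl(d)^+_tau *)
    (forall S, A S -> in_Glpos_tau d tau S) /\
    (exists U : Mat -> Prop, mx_open d U /\ forall S, A S <-> (U S /\ in_Glpos_tau d tau S)) /\
    A (RSop m k V) /\
    (* rho : A -> P_v is smooth *)
    (forall S, A S -> in_Pv m d k v (rho S)) /\
    smooth_sys_on_subset d m k A rho /\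
    (* cross section of RSO through V *)
    (forall S, A S -> meq d d (RSop m k (rho S)) S) /\
    (forall i, (i < m)%nat -> meq (k i) d (rho (RSop m k V) i) (V i)).
Proof.
subst tau; exact (MatrixEquation.local_cross_section hm hV hirr).
Qed.
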